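(* Let $K$ be a non-archimedean ordered field with natural valuation $v$, valuation ring $R_v$ = convex hull of $\mathbb{Q}$ in $K$, and $\mathbf{P}_K:=K^{>0}\setminus R_v$. Let $\sigma\neq\mathrm{id}$ be an order preserving field automorphism of $K$ with $\sigma(a)\ge a^2$ for all $a\in\mathbf{P}_K$. Let $\sim_\sigma$ be the equivalence relation on $\mathbf{P}_K$ given by $a\sim_\sigma a'$ iff there is $n\in\mathbb{N}_0$ with $\sigma^n(a)\ge a'$ and $\sigma^n(a')\ge a$, and order $\mathbf{P}_K/\sim_\sigma$ by $[a]<[b]$ iff $a'<b'$ for all $a'\in[a]$, $b'\in[b]$. Then the $\sigma$-rank $\mathcal{R}_\sigma$ is order isomorphic to the chain of non-empty initial segments of $\mathbf{P}_K/\sim_\sigma$ ordered by inclusion, and the principal $\sigma$-rank $\mathcal{R}_\sigma^{\rm pr}$ is order isomorphic to the subchain of those initial segments which have a last element.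
   Context: A valuation $w$ of $K$ is convex if $a\ge b>0\Rightarrow w(a)\le w(b)$, and $\sigma$-compatible if $w(a)\le w(b)\iff w(\sigma(a))\le w(\sigma(b))$ for all $a,b\in K$ (equivalently $\sigma(R_w)=R_w$). $\mathcal{R}_\sigma$ is the set of valuation rings $R_w\neq R_v$ of $\sigma$-compatible convex valuations, ordered by inclusion. A $\sigma$-compatible convex valuation ring $R_w\neq R_v$ is $\sigma$-principal (generated by $a\in\mathbf{P}_K$) if it is the smallest $\sigma$-compatible convex subring of $K$ containing $a$; $\mathcal{R}_\sigma^{\rm pr}$ is the set of $\sigma$-principal elements of $\mathcal{R}_\sigma$. The classes of $\sim_\sigma$ are convex, so the quotient order is well defined. *)

(* Defs.v *)
From mathcomp Require Import all_boot all_order all_algebra.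
From mathcomp Require Import boolp classical_sets functions.

Set Implicit Arguments.
Unset Strict Implicit.
Unset Printing Implicit Defensive.

Import Order.TTheory GRing.Theory Num.Theory.

Local Open Scope classical_set_scope.
Local Open Scope ring_scope.

(* [option G] stands for G extended by infinity, with [None] the infinite
   element: it is the greatest one and it absorbs addition. *)
Definition vle (G : porderZmodType) (x y : option G) : bool :=
  match x, y with
  | _, None => true
  | None, Some _ => false
  | Some g, Some h => g <= h
  end.

Definition vadd (G : porderZmodType) (x y : option G) : option G :=
  match x, y with
  | Some g, Some h => Some (g + h)
  | _, _ => None
  end.

Definition vmin (G : porderZmodType) (x y : option G) : option G :=
  if vle x y then x else y.

(* The first two axioms make the value group a totally ordered abelian group:
   [porderZmodType] alone does not relate the order to the addition. *)
Record valuation (K : fieldType) := Valuation {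
  value_group : porderZmodType;
  value_group_total : total (<=%R : rel value_group);
  value_group_leD2l : forall g h k : value_group, g <= h -> k + g <= k + h;
  valuation_fun :> K -> option value_group;
  valuation_eq_infty : forall a, valuation_fun a = None <-> a = 0;
  valuationM : forall a b,
    valuation_fun (a * b) = vadd (valuation_fun a) (valuation_fun b);
  valuationD : forall a b,
    vle (vmin (valuation_fun a) (valuation_fun b)) (valuation_fun (a + b))
}.

Definition valuation_ring (K : fieldType) (w : valuation K) : set K :=
  [set a | vle (Some 0) (w a)].

Definition convex_valuation (K : realFieldType) (w : valuation K) : Prop :=
  forall a b : K, b <= a -> 0 < b -> vle (w a) (w b).

Definition compatible_valuation (K : fieldType) (sigma : K -> K)
    (w : valuation K) : Prop :=
  forall a b : K, vle (w a) (w b) <-> vle (w (sigma a)) (w (sigma b)).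

(* The valuation ring of the natural valuation: the convex hull of the
   rationals. *)
Definition natural_ring (K : realFieldType) : set K :=
  [set x | exists p q : rat, ratr p <= x <= ratr q].
Arguments natural_ring K : clear implicits.

Definition pos_infinite (K : realFieldType) : set K :=
  [set a | 0 < a] `\` natural_ring K.
Arguments pos_infinite K : clear implicits.

Definition sigma_rank (K : realFieldType) (sigma : K -> K) : set (set K) :=
  [set A | A <> natural_ring K /\
    exists w : valuation K,
      [/\ convex_valuation w, compatible_valuation sigma w
        & A = valuation_ring w]].

Definition compatible_convex_subring (K : realFieldType) (sigma : K -> K)
    (B : set K) : Prop :=
  [/\ GRing.subring_closed (mem B),
      forall x y z, B x -> B y -> x <= z <= y -> B z
    & sigma @` B = B].

Definition sigma_generated (K : realFieldType) (sigma : K -> K)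
    (a : K) (A : set K) : Prop :=
  [/\ compatible_convex_subring sigma A, A a
    & forall B, compatible_convex_subring sigma B -> B a -> A `<=` B].

Definition principal_sigma_rank (K : realFieldType) (sigma : K -> K) :
    set (set K) :=
  [set A | sigma_rank sigma A /\
    exists2 a, pos_infinite K a & sigma_generated sigma a A].

Definition sigma_equiv (K : realFieldType) (sigma : K -> K) (a a' : K) : Prop :=
  exists n : nat, a' <= iter n sigma a /\ a <= iter n sigma a'.

Definition sigma_class (K : realFieldType) (sigma : K -> K) (a : K) : set K :=
  [set a' | pos_infinite K a' /\ sigma_equiv sigma a a'].

(* The quotient of [pos_infinite K] by [sigma_equiv sigma], as the set of its
   equivalence classes. *)
Definition sigma_quotient (K : realFieldType) (sigma : K -> K) : set (set K) :=
  sigma_class sigma @` pos_infinite K.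

Definition class_lt (K : realFieldType) (C D : set K) : Prop :=
  forall a b, C a -> D b -> a < b.

Definition class_le (K : realFieldType) (C D : set K) : Prop :=
  C = D \/ class_lt C D.

Definition initial_segment (K : realFieldType) (sigma : K -> K)
    (S : set (set K)) : Prop :=
  S `<=` sigma_quotient sigma /\
  forall C D, sigma_quotient sigma C -> S D -> class_le C D -> S C.

Definition has_last (K : realFieldType) (S : set (set K)) : Prop :=
  exists2 D, S D & forall C, S C -> class_le C D.

Definition initial_segments (K : realFieldType) (sigma : K -> K) :
    set (set (set K)) :=
  [set S | initial_segment sigma S /\ S !=set0].

Definition initial_segments_with_last (K : realFieldType) (sigma : K -> K) :
    set (set (set K)) :=
  [set S | initial_segments sigma S /\ has_last S].

(* Two families of sets, each ordered by inclusion, are order isomorphic. *)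
Definition order_isomorphic (T U : Type) (F : set (set T)) (G : set (set U)) :
    Prop :=
  exists f : set T -> set U,
    set_bij F G f /\
    forall X Y, F X -> F Y -> (X `<=` Y <-> f X `<=` f Y).

(* [sigma_equiv] is an equivalence relation on [pos_infinite K] and [class_lt]
   is a strict total order on the quotient. *)

Lemma sigma_equiv_refl (K : realFieldType) (sigma : K -> K) a :
  sigma_equiv sigma a a.
Proof. by exists 0%N. Qed.

Lemma sigma_equiv_sym (K : realFieldType) (sigma : K -> K) a b :
  sigma_equiv sigma a b -> sigma_equiv sigma b a.
Proof. by case=> n [? ?]; exists n. Qed.

Lemma iter_homo_le (K : realFieldType) (sigma : K -> K) n :
  {homo sigma : x y / x <= y} -> {homo iter n sigma : x y / x <= y}.
Proof. by move=> h x y xy; elim: n => //= n; apply: h. Qed.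

Lemma sigma_equiv_trans (K : realFieldType) (sigma : K -> K) a b c :
  {homo sigma : x y / x <= y} ->
  sigma_equiv sigma a b -> sigma_equiv sigma b c -> sigma_equiv sigma a c.
Proof.
move=> h [n [ab ba]] [m [bc cb]]; exists (m + n)%N; split.
  by rewrite iterD; apply: le_trans bc _; apply: iter_homo_le.
by rewrite addnC iterD; apply: le_trans ba _; apply: iter_homo_le.
Qed.

Lemma pos_infinite_gt1 (K : realFieldType) (a : K) : pos_infinite K a -> 1 < a.
Proof.
move=> [a0 aN]; rewrite ltNge; apply/negP => a1; apply: aN.
by exists 0, 1; rewrite rmorph0 rmorph1 a1 (ltW a0).
Qed.

Lemma pos_infinite_le (K : realFieldType) (a b : K) :
  pos_infinite K a -> a <= b -> pos_infinite K b.
Proof.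
move=> [a0 aN] ab; split; first exact: lt_le_trans ab.
move=> [p [q /andP[_ bq]]]; apply: aN; exists 0, q.
by rewrite rmorph0 (ltW a0) (le_trans ab bq).
Qed.

Lemma pos_infinite_iter_ge (K : realFieldType) (sigma : K -> K) n (a : K) :
  (forall a, pos_infinite K a -> a ^+ 2 <= sigma a) ->
  pos_infinite K a -> a <= iter n sigma a.
Proof.
move=> hs aP; elim: n => //= n IH.
have bP := pos_infinite_le aP IH.
apply: le_trans IH (le_trans _ (hs _ bP)).
by rewrite expr2 ler_peMl ?ltW// ?pos_infinite_gt1//; case: bP.
Qed.

Lemma sigma_equiv_convex (K : realFieldType) (sigma : K -> K) (a b c : K) :
  (forall a, pos_infinite K a -> a ^+ 2 <= sigma a) ->
  pos_infinite K a -> a <= b <= c -> sigma_equiv sigma a c ->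
  sigma_equiv sigma a b.
Proof.
move=> hs aP /andP[ab bc] [n [ca _]]; exists n; split; first exact: le_trans ca.
by apply: le_trans ab (pos_infinite_iter_ge _ hs (pos_infinite_le aP ab)).
Qed.

Lemma class_lt_irr (K : realFieldType) (sigma : K -> K) (C : set K) :
  sigma_quotient sigma C -> ~ class_lt C C.
Proof.
case=> a aP <- /(_ a a).
have aC : sigma_class sigma a a by split=> //; apply: sigma_equiv_refl.
by move=> /(_ aC aC); rewrite ltxx.
Qed.

Lemma class_lt_trans (K : realFieldType) (sigma : K -> K) (C D E : set K) :
  sigma_quotient sigma D -> class_lt C D -> class_lt D E -> class_lt C E.
Proof.
case=> b bP <- CD DE a c aC cE.
have bD : sigma_class sigma b b by split=> //; apply: sigma_equiv_refl.
exact: lt_trans (CD _ _ aC bD) (DE _ _ bD cE).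
Qed.

Lemma class_le_total (K : realFieldType) (sigma : K -> K) (C D : set K) :
  {homo sigma : x y / x <= y} ->
  (forall a, pos_infinite K a -> a ^+ 2 <= sigma a) ->
  sigma_quotient sigma C -> sigma_quotient sigma D ->
  class_le C D \/ class_le D C.
Proof.
move=> h hs [a aP <-] [b bP <-].
have eqC x y : sigma_equiv sigma x y -> sigma_class sigma x = sigma_class sigma y.
  move=> xy; apply/seteqP; split=> z [zP xz]; split=> //.
    exact: sigma_equiv_trans (sigma_equiv_sym xy) xz.
  exact: sigma_equiv_trans xy xz.
have [ab|nab] := pselect (sigma_equiv sigma a b); first by left; left; exact: eqC.
have lt_class x y : pos_infinite K x -> pos_infinite K y -> ~ sigma_equiv sigma x y ->
    x <= y -> class_lt (sigma_class sigma x) (sigma_class sigma y).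
  move=> xP yP nxy xy u v [uP xu] [vP yv]; rewrite ltNge; apply/negP => vu.
  apply: nxy; have [yu|uy] := leP y u.
    by apply: sigma_equiv_convex xu => //; rewrite xy yu.
  apply: sigma_equiv_trans xu _ => //; apply: sigma_equiv_trans _ (sigma_equiv_sym yv) => //.
  apply: sigma_equiv_sym; apply: sigma_equiv_convex (sigma_equiv_sym yv) => //.
  by rewrite vu ltW.
have [ab|ba] := leP a b; first by left; right; apply: lt_class.
right; right; apply: lt_class => //; last exact: ltW.
by move/sigma_equiv_sym.
Qed.

(* Main.v *)
(** The [sigma]-compatible convex valuation rings are exactly the convex
    subrings [A] with [sigma @` A = A]: conversely such an [A] contains [x] or
    [x^-1] for every [x], so it is the valuation ring of the quotient map onto
    [K^* / A^*], ordered by [x A^* <= y A^*] iff [y / x] lies in [A].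

    Such an [A] meets [pos_infinite K] in a union of [sigma]-classes forming an
    initial segment.  In the other direction the elements bounded in absolute
    value by a member of a class of a nonempty set of classes form a convex
    subring, because [sigma a >= a ^+ 2] stays in the class of [a] and dominates
    both [2 * a] and [a * a].  The ring generated by [a] corresponds to the
    initial segment with last element the class of [a]. *)

Require Import Defs.
From HB Require Import structures.
From mathcomp Require Import all_boot all_order all_algebra.
From mathcomp Require Import boolp classical_sets functions.

Import Order.TTheory GRing.Theory Num.Theory.

Local Open Scope classical_set_scope.
Local Open Scope ring_scope.

(** * Convex subrings and the cosets of their units *)

Record convex_subring (K : realFieldType) := ConvexSubring {
  subring_set :> K -> Prop;
  subring1 : subring_set 1;
  subringB : forall x y, subring_set x -> subring_set y -> subring_set (x - y);
  subringM : forall x y, subring_set x -> subring_set y -> subring_set (x * y);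
  subring_convex : forall x y z,
    subring_set x -> subring_set y -> x <= z <= y -> subring_set z
}.
Arguments subring_set {K}.
Arguments subring1 {K}.
Arguments subringB {K}.
Arguments subringM {K}.
Arguments subring_convex {K}.

Section ConvexSubringTheory.
Context {K : realFieldType}.
Implicit Types (A : convex_subring K) (a b x y z : K).

Lemma subring0 A : A 0.
Proof. by rewrite -(subrr 1); apply: subringB; apply: subring1. Qed.

Lemma subringN A x : A x -> A (- x).
Proof. by move=> Ax; rewrite -sub0r; apply: subringB => //; apply: subring0. Qed.

Lemma subringD A x y : A x -> A y -> A (x + y).
Proof. by move=> Ax Ay; rewrite -[y]opprK; apply/subringB/subringN. Qed.

Lemma subring_norm_le A x y : A y -> `|x| <= y -> A x.
Proof.
move=> Ay; rewrite ler_norml => xy.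
exact: subring_convex (subringN A _ Ay) Ay xy.
Qed.

Lemma subring_norm A x : A x -> A `|x|.
Proof. by move=> Ax; case: (ler0P x) => // _; apply: subringN. Qed.

(** One of [|x|] and [|x^-1|] is at most 1, and convexity puts the whole interval from -1 to 1
    inside [A]. *)
Lemma subring_or_inv A x : A x \/ A x^-1.
Proof.
have [x1|x1] := leP `|x| 1; [left|right].
  exact: subring_norm_le (subring1 A) x1.
apply: subring_norm_le (subring1 A) _.
by rewrite normfV invf_le1 ?ltW// (lt_trans ltr01).
Qed.

Lemma subring_nat A n : A n%:R.
Proof.
by elim: n => [|n An]; [apply: subring0|rewrite -natr1; apply/subringD/subring1].
Qed.

(** Every rational is bounded in absolute value by a natural number, which lies in [A]. Thus only
    infinite elements can distinguish two convex subrings. *)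
Lemma natural_ring_sub A : natural_ring K `<=` subring_set A.
Proof.
have Arat (r : rat) : A (ratr r).
  have [n rn] : exists n : nat, `|r| <= n%:R.
    by exists (Num.bound `|r|); rewrite ltW ?archi_boundP.
  apply: subring_norm_le (subring_nat A n) _.
  by rewrite -ratr_norm -[n%:R]ratr_nat ler_rat.
by move=> x [p [q pxq]]; apply: subring_convex pxq.
Qed.

(** The two memberships say that [y / x] is a unit of [A]. For [x != 0] the default [x] satisfies
    the predicate, so the value of [choose] depends on the predicate alone, that is, on the coset of
    [x]. *)
Definition coset_repr A (x : K) : K :=
  choose (fun y => `[< y != 0 /\ (A (y / x) /\ A (x / y)) >]) x.

Lemma coset_reprP A x : x != 0 ->
  [/\ coset_repr A x != 0, A (coset_repr A x / x) & A (x / coset_repr A x)].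
Proof.
move=> x0; suff /asboolP[? []] :
  `[< coset_repr A x != 0 /\ (A (coset_repr A x / x) /\ A (x / coset_repr A x)) >] by [].
by apply: (@chooseP _ (fun y => `[< y != 0 /\ (A (y / x) /\ A (x / y)) >]));
  apply/asboolP; rewrite divff//; split=> //; split; apply: subring1.
Qed.

Lemma subring_div_trans A y x z :
  y != 0 -> A (x / y) -> A (y / z) -> A (x / z).
Proof.
by move=> y0 xy yz; have := subringM A _ _ xy yz; rewrite mulrA divfK.
Qed.

Lemma eq_coset_repr A x y : x != 0 -> y != 0 ->
  A (x / y) -> A (y / x) -> coset_repr A x = coset_repr A y.
Proof.
move=> x0 y0 xy yx; rewrite /coset_repr.
have e : (fun z => `[< z != 0 /\ (A (z / x) /\ A (x / z)) >]) =1
         (fun z => `[< z != 0 /\ (A (z / y) /\ A (y / z)) >]).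
  move=> z; apply/asboolP/asboolP => -[z0 [h1 h2]]; split=> //; split.
  - exact: subring_div_trans x0 h1 xy.
  - exact: subring_div_trans x0 yx h2.
  - exact: subring_div_trans y0 h1 yx.
  - exact: subring_div_trans y0 xy h2.
rewrite (eq_choose e); apply: choose_id; apply/asboolP; rewrite ?divff//.
by split=> //; split; apply: subring1.
Qed.

(** The choice of representatives is idempotent on nonzero elements, so each coset has exactly one
    fixed point and the quotient can be realised as a subtype of [K]. *)
Definition is_coset_repr A : pred K := fun x => (x != 0) && (coset_repr A x == x).

Lemma coset_repr_is_coset_repr A x : x != 0 -> is_coset_repr A (coset_repr A x).
Proof.
move=> x0; have [r0 rx xr] := coset_reprP A x x0.
by rewrite /is_coset_repr r0 (eq_coset_repr A _ x)/=.
Qed.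
End ConvexSubringTheory.

(* [K^* / A^*], each coset being stored as a chosen representative. *)
Record quotient_group (K : realFieldType) (A : convex_subring K) := QuotientGroup {
  group_repr : K;
  group_reprP : is_coset_repr A group_repr
}.

Arguments group_repr {K A}.
Arguments group_reprP {K A}.

HB.instance Definition _ (K : realFieldType) (A : convex_subring K) :=
  [isSub for @group_repr K A].
HB.instance Definition _ (K : realFieldType) (A : convex_subring K) :=
  [Choice of quotient_group K A by <:].

(** * The ordered group of cosets, written additively *)

Section QuotientGroupTheory.
Context {K : realFieldType} (A : convex_subring K).
Implicit Types (x y z : K) (u v : quotient_group K A).

Definition coset1 : quotient_group K A :=
  QuotientGroup K A _ (coset_repr_is_coset_repr A 1 (oner_neq0 K)).

(* The junk value [coset 0] is the neutral coset. *)
Definition coset x : quotient_group K A := insubd coset1 (coset_repr A x).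

Lemma group_repr_coset x : x != 0 -> group_repr (coset x) = coset_repr A x.
Proof.
by move=> x0; rewrite -[LHS]/(val _) insubdK//; apply: coset_repr_is_coset_repr.
Qed.

Lemma group_repr_neq0 u : group_repr u != 0.
Proof. by case/andP: (group_reprP u). Qed.

Lemma group_reprK u : coset (group_repr u) = u.
Proof.
apply: val_inj; rewrite /= group_repr_coset ?group_repr_neq0//.
by case/andP: (group_reprP u) => _ /eqP.
Qed.

(** Reduces each group or order law to nonzero field elements, where it becomes an identity or a
    divisibility statement in [K]. *)
Lemma coset_ind (P : quotient_group K A -> Prop) :
  (forall x, x != 0 -> P (coset x)) -> forall u, P u.
Proof. by move=> h u; rewrite -(group_reprK u); apply/h/group_repr_neq0. Qed.

Lemma eq_coset x y : x != 0 -> y != 0 ->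
  A (x / y) -> A (y / x) -> coset x = coset y.
Proof.
by move=> x0 y0 xy yx; rewrite /coset (eq_coset_repr A x y).
Qed.

Definition coset_add u v := coset (group_repr u * group_repr v).
Definition coset_opp u := coset (group_repr u)^-1.
Definition coset_le u v := `[< A (group_repr v / group_repr u) >].

Lemma coset_addE x y : x != 0 -> y != 0 ->
  coset_add (coset x) (coset y) = coset (x * y).
Proof.
move=> x0 y0; rewrite /coset_add !group_repr_coset//.
have [rx0 rx xr] := coset_reprP A x x0; have [ry0 ry yr] := coset_reprP A y y0.
by apply: eq_coset; rewrite ?mulf_neq0// invfM mulrACA; apply: subringM.
Qed.

Lemma coset_oppE x : x != 0 -> coset_opp (coset x) = coset x^-1.
Proof.
move=> x0; rewrite /coset_opp group_repr_coset//.
have [rx0 rx xr] := coset_reprP A x x0.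
by apply: eq_coset; rewrite ?invr_neq0// invrK mulrC.
Qed.

Lemma coset_leE x y : x != 0 -> y != 0 ->
  coset_le (coset x) (coset y) <-> A (y / x).
Proof.
move=> x0 y0; rewrite /coset_le !group_repr_coset//.
have [rx0 rx xr] := coset_reprP A x x0; have [ry0 ry yr] := coset_reprP A y y0.
split=> [/asboolP yx|yx].
  apply: subring_div_trans ry0 yr _; exact: subring_div_trans rx0 yx rx.
apply/asboolP; apply: subring_div_trans y0 ry _; exact: subring_div_trans x0 yx xr.
Qed.

Lemma coset_addA : associative coset_add.
Proof.
elim/coset_ind=> x x0; elim/coset_ind=> y y0; elim/coset_ind=> z z0.
by rewrite !coset_addE ?mulf_neq0// mulrA.
Qed.

Lemma coset_addC : commutative coset_add.
Proof. by move=> u v; rewrite /coset_add mulrC. Qed.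

Lemma coset_add0 : left_id (coset 1) coset_add.
Proof.
by elim/coset_ind=> x x0; rewrite coset_addE ?oner_neq0// mul1r.
Qed.

Lemma coset_addN : left_inverse (coset 1) coset_opp coset_add.
Proof.
elim/coset_ind=> x x0.
by rewrite coset_oppE// coset_addE ?invr_neq0// mulVf.
Qed.

Lemma coset_le_refl : reflexive coset_le.
Proof.
by elim/coset_ind=> x x0; apply/coset_leE; rewrite ?divff//; apply: subring1.
Qed.

Lemma coset_le_anti : antisymmetric coset_le.
Proof.
elim/coset_ind=> x x0; elim/coset_ind=> y y0 /andP[].
by move=> /coset_leE-/(_ x0 y0) yx /coset_leE-/(_ y0 x0) xy; apply: eq_coset.
Qed.

Lemma coset_le_trans : transitive coset_le.
Proof.
elim/coset_ind=> x x0; elim/coset_ind=> y y0; elim/coset_ind=> z z0.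
move=> /coset_leE-/(_ y0 x0) xy /coset_leE-/(_ x0 z0) zx.
by apply/coset_leE => //; apply: subring_div_trans x0 zx xy.
Qed.
End QuotientGroupTheory.

HB.instance Definition _ (K : realFieldType) (A : convex_subring K) :=
  GRing.isZmodule.Build (quotient_group K A)
    (coset_addA A) (coset_addC A) (coset_add0 A) (coset_addN A).
HB.instance Definition _ (K : realFieldType) (A : convex_subring K) :=
  Order.isPOrder.Build ring_display (quotient_group K A)
    (fun u v => erefl) (coset_le_refl A) (coset_le_anti A) (coset_le_trans A).

(** * The valuation attached to a convex subring *)

Section QuotientValuation.
Context {K : realFieldType} (A : convex_subring K).
Implicit Types (x y z : K) (u v : quotient_group K A).

Lemma le_coset x y : x != 0 -> y != 0 ->
  (coset A x <= coset A y)%R <-> A (y / x).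
Proof. exact: coset_leE. Qed.

Lemma coset_total : total (<=%R : rel (quotient_group K A)).
Proof.
elim/(@coset_ind K A)=> x x0; elim/(@coset_ind K A)=> y y0; apply/orP.
have [h|h] := subring_or_inv A (y / x); [left|right]; apply/le_coset => //.
by rewrite invf_div in h.
Qed.

Lemma coset_leD2l u v w : u <= v -> w + u <= w + v.
Proof.
elim/(@coset_ind K A): u => x x0; elim/(@coset_ind K A): v => y y0.
elim/(@coset_ind K A): w => z z0.
move=> /le_coset-/(_ x0 y0) yx.
rewrite -![_ + _]/(coset_add A _ _) !coset_addE//.
by apply/le_coset; rewrite ?mulf_neq0// -mulf_div divff// mul1r.
Qed.

Definition coset_valuation_fun x : option (quotient_group K A) :=
  if x == 0 then None else Some (coset A x).

Lemma coset_valuation_eq_infty x : coset_valuation_fun x = None <-> x = 0.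
Proof. by rewrite /coset_valuation_fun; case: eqP. Qed.

Lemma coset_valuationM x y : coset_valuation_fun (x * y) =
  vadd (coset_valuation_fun x) (coset_valuation_fun y).
Proof.
rewrite /coset_valuation_fun mulf_eq0.
have [//|x0] := eqVneq x 0; have [//|y0] := eqVneq y 0.
by rewrite /= -coset_addE.
Qed.

(** Because [y / 0 = 0] lies in [A], the membership alone would hold for [x = 0] and any [y]; the
    implication restores that only 0 has a value above infinity. *)
Lemma vle_coset_valuation x y :
  vle (coset_valuation_fun x) (coset_valuation_fun y) <->
  (x = 0 -> y = 0) /\ A (y / x).
Proof.
rewrite /coset_valuation_fun.
have [->|y0] := eqVneq y 0.
  by case: (x == 0); split=> // _; rewrite mul0r; split=> //; apply: subring0.
have [->|x0] := eqVneq x 0.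
  by split=> // -[/(_ erefl)] /eqP; rewrite (negPf y0).
split=> /= [/le_coset-/(_ x0 y0) h|[_ h]]; last exact/le_coset.
by split=> // /eqP; rewrite (negPf x0).
Qed.

Lemma coset_valuationD x y :
  vle (vmin (coset_valuation_fun x) (coset_valuation_fun y))
      (coset_valuation_fun (x + y)).
Proof.
(* When [a] has the smaller value, [(a + b) / a = 1 + b / a] is a sum of two elements of [A]. *)
have main a b : vle (coset_valuation_fun a) (coset_valuation_fun b) ->
    vle (coset_valuation_fun a) (coset_valuation_fun (a + b)).
  move=> /vle_coset_valuation[ab Aba]; apply/vle_coset_valuation; split.
    by move=> a0; rewrite ab // a0 addr0.
  have [->|a0] := eqVneq a 0; first by rewrite invr0 mulr0; apply: subring0.
  by rewrite mulrDl divff//; apply: subringD => //; apply: subring1.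
rewrite /vmin; case: ifP => [|/negP xy]; first exact: main.
rewrite addrC; apply: main; apply/vle_coset_valuation.
(* It remains to see that [y] has the smaller value once the comparison of [x] with [y] fails; for
   nonzero elements this is [subring_or_inv] applied to [y / x]. *)
have [x0|x0] := eqVneq x 0.
  rewrite x0 mul0r; split=> //; exact: subring0.
have [y0|y0] := eqVneq y 0.
  case: xy; apply/vle_coset_valuation; split=> //.
  by rewrite y0 mul0r; apply: subring0.
split; first by move/eqP; rewrite (negPf y0).
have [h|] := subring_or_inv A (y / x); last by rewrite invf_div.
case: xy; apply/vle_coset_valuation; split=> // /eqP; by rewrite (negPf x0).
Qed.

Definition coset_valuation : valuation K :=
  @Valuation K (quotient_group K A : porderZmodType) coset_total coset_leD2l
    coset_valuation_fun coset_valuation_eq_infty coset_valuationM coset_valuationD.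

Lemma coset_valuation_ring : valuation_ring coset_valuation = subring_set A.
Proof.
(* The neutral coset is the value of 1, so membership of [x] in the ring becomes [A (x / 1)]. *)
have v1 : Some (0 : quotient_group K A) = coset_valuation_fun 1.
  by rewrite /coset_valuation_fun oner_eq0.
have memE x : valuation_ring coset_valuation x =
    vle (Some (0 : quotient_group K A)) (coset_valuation_fun x) by [].
apply/seteqP; split=> x; rewrite memE v1.
  by case/vle_coset_valuation => _; rewrite divr1.
move=> Ax; apply/vle_coset_valuation; rewrite divr1; split=> // /eqP.
by rewrite oner_eq0.
Qed.

Lemma coset_valuation_convex : convex_valuation coset_valuation.
Proof.
move=> a b ba b0; have a0 := lt_le_trans b0 ba.
apply/vle_coset_valuation; split; first by move=> a00; rewrite a00 ltxx in a0.
apply: subring_norm_le (subring1 A) _.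
by rewrite ger0_norm ?(divr_ge0 (ltW b0) (ltW a0))// ler_pdivrMr// mul1r.
Qed.

Lemma coset_valuation_compatible (sigma : {rmorphism K -> K}) :
  sigma @` subring_set A = subring_set A -> compatible_valuation sigma coset_valuation.
Proof.
move=> sA a b.
(* Injectivity of [sigma] turns the equality of sets into an equivalence, which applies to quotients
   since [sigma] commutes with division. *)
have sAE x : A (sigma x) <-> A x.
  split=> [|Ax]; last by rewrite -sA; exists x.
  by rewrite -{1}sA => -[y Ay /fmorph_inj <-].
split=> /vle_coset_valuation[ab Aba]; apply/vle_coset_valuation; split.
- by move=> /eqP; rewrite fmorph_eq0 => /eqP/ab ->; rewrite rmorph0.
- by rewrite -fmorph_div; apply/sAE.
- by move=> a0; apply/eqP; rewrite -(fmorph_eq0 sigma) ab// a0 rmorph0.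
- by apply/sAE; rewrite fmorph_div.
Qed.
End QuotientValuation.

(** * The valuation ring of a convex valuation *)

Section ConvexValuationRing.
Context {K : realFieldType} (w : valuation K).

Let G := value_group w.

Lemma value_leD (g h g' h' : G) : g <= h -> g' <= h' -> g + g' <= h + h'.
Proof.
move=> gh gh'; apply: (@le_trans _ _ (g + h')); first exact: value_group_leD2l.
by rewrite ![_ + h']addrC; apply: value_group_leD2l.
Qed.

Lemma valuation1 : w 1 = Some 0.
Proof.
have := valuationM w 1 1; rewrite mulr1.
case w1 : (w 1) => [g|] /=.
  by move=> [/eqP]; rewrite -subr_eq subrr => /eqP <-.
by move/valuation_eq_infty: w1 => /eqP; rewrite oner_eq0.
Qed.

Lemma valuationN x : w (- x) = w x.
Proof.
(* Twice the value of -1 is the value of 1, which is 0, and a totally ordered group has no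
   2-torsion. *)
have wN1 : w (-1) = Some 0.
  have := valuationM w (-1) (-1); rewrite mulrNN mulr1 valuation1.
  case: (w (-1)) => [g|//] /= [/esym gg0].
  congr Some; apply: le_anti.
  have [g0|g0] := orP (value_group_total g 0); rewrite g0 ?andbT/=.
    by have := value_group_leD2l g g0; rewrite gg0 addr0.
  by have := value_group_leD2l g g0; rewrite gg0 addr0.
rewrite -mulN1r valuationM wN1; case: (w x) => //= g; by rewrite add0r.
Qed.

Lemma vle_trans {x y z : option G} : vle x y -> vle y z -> vle x z.
Proof. by case: x y z => [x|] [y|] [z|] //=; apply: le_trans. Qed.

Lemma valuation_ringB x y : valuation_ring w x -> valuation_ring w y ->
  valuation_ring w (x - y).
Proof.
rewrite /valuation_ring /mkset -(valuationN y) => wx wy.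
by apply: vle_trans _ (valuationD w x (- y)); rewrite /vmin; case: ifP.
Qed.

Lemma valuation_ringM x y : valuation_ring w x -> valuation_ring w y ->
  valuation_ring w (x * y).
Proof.
rewrite /valuation_ring /= valuationM.
case: (w x) (w y) => [g|] [h|] //= g0 h0.
by rewrite -[0]addr0; apply: value_leD.
Qed.

Lemma valuation_ring1 : valuation_ring w 1.
Proof. by rewrite /valuation_ring /= valuation1 /=. Qed.

Lemma valuation_ring_convex : convex_valuation w ->
  forall x y z, valuation_ring w x -> valuation_ring w y -> x <= z <= y ->
  valuation_ring w z.
Proof.
move=> wc x y z Ax Ay /andP[xz zy].
(* [convex_valuation] compares positive elements only: a positive [z] is compared with [y], a
   negative one through [- z <= - x], and 0 is [1 - 1]. *)
have [z0|z0|->] := ltrgt0P z; last first.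
- by rewrite -(subrr 1); apply: valuation_ringB; apply: valuation_ring1.
- rewrite /valuation_ring /mkset -valuationN.
  apply: vle_trans _ (wc (- x) (- z) _ _); rewrite ?lerN2 ?oppr_gt0//.
  by rewrite valuationN.
- exact: vle_trans Ay (wc _ _ zy z0).
Qed.
End ConvexValuationRing.

(** * Compatible valuations versus [sigma]-stable convex subrings *)

Section SigmaRank.
Context {K : realFieldType} (sigma : {rmorphism K -> K}).

Lemma compatible_convex_subringP (B : set K) :
  compatible_convex_subring sigma B <->
  (exists A : convex_subring K, B = subring_set A) /\ sigma @` B = B.
Proof.
split=> [[[B1 BB BM] Bc sB]|[[A ->] sA]]; last first.
  split=> //; last exact: subring_convex.
  split; first by apply: mem_set; apply: subring1.
    by move=> x y /set_mem Ax /set_mem Ay; apply: mem_set; apply: subringB.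
  by move=> x y /set_mem Ax /set_mem Ay; apply: mem_set; apply: subringM.
split=> //; have B1' : B 1 by apply: set_mem.
have BB' x y : B x -> B y -> B (x - y).
  by move=> /mem_set Bx /mem_set By; apply: set_mem; apply: BB.
have BM' x y : B x -> B y -> B (x * y).
  by move=> /mem_set Bx /mem_set By; apply: set_mem; apply: BM.
by exists (ConvexSubring K B B1' BB' BM' Bc).
Qed.

Lemma compatible_valuation_image (w : valuation K) : bijective sigma ->
  compatible_valuation sigma w -> sigma @` valuation_ring w = valuation_ring w.
Proof.
move=> [tau sigmaK tauK] wc.
(* Compatibility is applied to the pair [1], [x]: [sigma] fixes 1, whose value is 0. *)
have wcE x : valuation_ring w x <-> valuation_ring w (sigma x).
  by have := wc 1 x; rewrite rmorph1 valuation1.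
apply/seteqP; split=> [_ [x Ax <-]|x Ax]; first exact: (wcE x).1.
by exists (tau x) => //; apply: (wcE _).2; rewrite tauK.
Qed.

(** Eliminates valuations: the remaining arguments handle subrings only. *)
Lemma sigma_rankP (B : set K) : bijective sigma ->
  sigma_rank sigma B <-> B <> natural_ring K /\ compatible_convex_subring sigma B.
Proof.
move=> sbij; split=> -[Bn].
  move=> [w [wc ws BE]]; subst B; split=> //; apply/compatible_convex_subringP.
  split; last exact: compatible_valuation_image.
  by exists (ConvexSubring K (valuation_ring w) (valuation_ring1 w)
    (valuation_ringB w) (valuation_ringM w) (valuation_ring_convex w wc)).
move=> /compatible_convex_subringP[[A BA] sA]; split=> //; subst B.
exists (coset_valuation A); split; last by rewrite coset_valuation_ring.
  exact: coset_valuation_convex.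
exact: coset_valuation_compatible.
Qed.

Context (sigma_bij : bijective sigma).
Context (sigma_homo : {homo sigma : x y / x <= y}).
Context (sigma_ge_sqr : forall a : K, pos_infinite K a -> a ^+ 2 <= sigma a).

(** * Classes of positive infinite elements *)

Lemma sigma_class_refl a : pos_infinite K a -> sigma_class sigma a a.
Proof. by move=> aP; split=> //; apply: sigma_equiv_refl. Qed.

Lemma eq_sigma_class a b : sigma_equiv sigma a b ->
  sigma_class sigma a = sigma_class sigma b.
Proof.
move=> ab; apply/seteqP; split=> z [zP xz]; split=> //.
  exact: sigma_equiv_trans (sigma_equiv_sym ab) xz.
exact: sigma_equiv_trans ab xz.
Qed.

Lemma sigma_quotientE C a : sigma_quotient sigma C -> C a ->
  C = sigma_class sigma a.
Proof. by move=> [b bP <-] [aP ab]; apply: eq_sigma_class. Qed.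

Lemma sigma_quotient_pos C a : sigma_quotient sigma C -> C a -> pos_infinite K a.
Proof. by move=> [b bP <-] []. Qed.

(** Exponent 1 works, since [a <= sigma a <= sigma (sigma a)]. This leaves room inside a class for
    bounds on sums and products. *)
Lemma sigma_quotient_sigma C a : sigma_quotient sigma C -> C a -> C (sigma a).
Proof.
move=> CQ Ca; have aP := sigma_quotient_pos C a CQ Ca.
rewrite (sigma_quotientE C a CQ Ca).
have le1 := pos_infinite_iter_ge 1 sigma_ge_sqr aP.
split; first exact: pos_infinite_le aP le1.
exists 1%N; split=> //=; exact: (le_trans le1 (sigma_homo _ _ le1)).
Qed.

Lemma class_le_sigma_class a b : pos_infinite K a -> a <= b ->
  class_le (sigma_class sigma a) (sigma_class sigma b).
Proof.
move=> aP ab; have bP := pos_infinite_le aP ab.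
have aQ : sigma_quotient sigma (sigma_class sigma a) by exists a.
have bQ : sigma_quotient sigma (sigma_class sigma b) by exists b.
have [//|[->|/(_ _ _ (sigma_class_refl b bP) (sigma_class_refl a aP))]] :=
  class_le_total sigma_homo sigma_ge_sqr aQ bQ; first by left.
by rewrite ltNge ab.
Qed.

Lemma compatible_convex_subring_iter (B : set K) n a :
  compatible_convex_subring sigma B -> B a -> B (iter n sigma a).
Proof.
by case=> _ _ sB Ba; elim: n => //= n IH; rewrite -sB; exists (iter n sigma a).
Qed.

(** If the classes agree, [a] lies below some iterate of [sigma] at [b], which is still in [B]; if
    they differ, [a] lies below [b] itself. Convexity does the rest, so [B] is governed by the
    classes it meets. *)
Lemma class_le_mem (B : set K) a b x : compatible_convex_subring sigma B ->
  B b -> pos_infinite K a -> pos_infinite K b ->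
  class_le (sigma_class sigma a) (sigma_class sigma b) -> `|x| <= a -> B x.
Proof.
move=> Bcc Bb aP bP ab xa.
have [c Bc ac] : exists2 c, B c & a <= c.
  case: ab => [E|/(_ a b (sigma_class_refl a aP) (sigma_class_refl b bP))/ltW ab];
    last by exists b.
  have [_ [n [ban abn]]] : sigma_class sigma a b by rewrite E; apply: sigma_class_refl.
  by exists (iter n sigma b) => //; apply: compatible_convex_subring_iter.
have /compatible_convex_subringP[[A BA] _] := Bcc; rewrite BA in Bc *.
exact: subring_norm_le Bc (le_trans xa ac).
Qed.

Lemma natural_ring_norm x : natural_ring K `|x| -> natural_ring K x.
Proof.
move=> [p [q /andP[_]]]; rewrite ler_norml => xq.
by exists (- q), q; rewrite rmorphN.
Qed.

Lemma pos_infinite_norm_le a : pos_infinite K a -> `|a| <= a.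
Proof. by move=> [a0 _]; rewrite ger0_norm// ltW. Qed.

Lemma pos_infinite_norm x : ~ natural_ring K x -> pos_infinite K `|x|.
Proof.
move=> xN; split; last by move/natural_ring_norm.
rewrite /= normr_gt0; apply/eqP => x0; apply: xN.
by exists 0, 0; rewrite rmorph0 x0 lexx.
Qed.

(** * Passing between subrings and initial segments *)

Definition segment_of_ring (A : set K) : set (set K) :=
  sigma_class sigma @` (A `&` pos_infinite K).

Definition ring_of_segment (S : set (set K)) : set K :=
  [set x | exists C a, [/\ S C, C a & `|x| <= a]].

Lemma ring_of_segment_compatible (S : set (set K)) :
  S `<=` sigma_quotient sigma -> S !=set0 ->
  compatible_convex_subring sigma (ring_of_segment S).
Proof.
move=> SQ [C0 SC0].
have [a0 Ca0] : exists a0, C0 a0.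
  by have [a aP <-] := SQ _ SC0; exists a; apply: sigma_class_refl.
have pos C a : S C -> C a -> pos_infinite K a.
  by move=> SC; apply: sigma_quotient_pos; apply: SQ.
(* A bound by [a ^+ 2] is as good as one by [a], because [sigma a] dominates it within the same
   class. *)
have sqr C a x : S C -> C a -> `|x| <= a ^+ 2 -> ring_of_segment S x.
  move=> SC Ca xa; exists C, (sigma a); split=> //.
    by apply: sigma_quotient_sigma => //; apply: SQ.
  by apply: le_trans xa _; apply: sigma_ge_sqr; apply: pos Ca.
have join x y : ring_of_segment S x -> ring_of_segment S y ->
    exists C a, [/\ S C, C a, `|x| <= a & `|y| <= a].
  move=> [C [a [SC Ca xa]]] [D [b [SD Db yb]]].
  have [ab|/ltW ba] := leP a b.
    by exists D, b; split=> //; apply: le_trans xa ab.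
  by exists C, a; split=> //; apply: le_trans yb ba.
have R1 : ring_of_segment S 1.
  exists C0, a0; split=> //; rewrite normr1 ltW//.
  by apply: pos_infinite_gt1; apply: pos Ca0.
have RB x y : ring_of_segment S x -> ring_of_segment S y -> ring_of_segment S (x - y).
  move=> Rx Ry; have [C [a [SC Ca xa ya]]] := join _ _ Rx Ry.
  have aP := pos _ _ SC Ca.
  (* An infinite [a] exceeds 2, so the bound [a + a] on the difference is at most [a ^+ 2]. *)
  have a2 : 2 <= a.
    rewrite leNgt; apply/negP => a2; apply: (proj2 aP).
    by exists 0, 2; rewrite rmorph0 ratr_nat !ltW//; case: aP.
  apply: (sqr C a) => //; apply: le_trans (ler_normB _ _) _.
  apply: le_trans (lerD xa ya) _.
  rewrite -mulr2n -mulr_natl expr2 ler_wpM2r//; exact: ltW (proj1 aP).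
have RM x y : ring_of_segment S x -> ring_of_segment S y -> ring_of_segment S (x * y).
  move=> Rx Ry; have [C [a [SC Ca xa ya]]] := join _ _ Rx Ry.
  by apply: (sqr C a) => //; rewrite normrM expr2 ler_pM.
have Rc x y z : ring_of_segment S x -> ring_of_segment S y -> x <= z <= y ->
    ring_of_segment S z.
  move=> Rx Ry /andP[xz zy]; have [C [a [SC Ca xa ya]]] := join _ _ Rx Ry.
  exists C, a; split=> //; rewrite ler_norml.
  move: xa ya; rewrite !ler_norml => /andP[xa _] /andP[_ ya].
  by rewrite (le_trans xa xz) (le_trans zy ya).
apply/compatible_convex_subringP; split.
  by exists (ConvexSubring K _ R1 RB RM Rc).
have sigma_norm x : `|sigma x| = sigma `|x|.
  case: (ler0P x) => x0; last first.
    by rewrite ger0_norm// -(rmorph0 sigma) sigma_homo// ltW.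
  by rewrite rmorphN ler0_norm// -(rmorph0 sigma) sigma_homo.
apply/seteqP; split=> [_ [x [C [a [SC Ca xa]]] <-]|x [C [a [SC Ca xa]]]].
  exists C, (sigma a); split=> //.
    by apply: sigma_quotient_sigma => //; apply: SQ.
  by rewrite sigma_norm; apply: sigma_homo.
(* The preimage of [x] is bounded by the same [a]: were [a] smaller than its absolute value, then
   [sigma a <= |x| <= a <= sigma a], and injectivity of [sigma] would contradict strictness. *)
have [tau sigmaK tauK] := sigma_bij.
exists (tau x); last exact: tauK.
exists C, a; split=> //; rewrite leNgt; apply/negP => a_lt.
have := sigma_homo _ _ (ltW a_lt); rewrite -sigma_norm tauK => sa.
have as_ := pos_infinite_iter_ge 1 sigma_ge_sqr (pos _ _ SC Ca).
have /(fmorph_inj sigma) E : sigma a = sigma `|tau x|.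
  rewrite -sigma_norm tauK; apply: le_anti.
  by rewrite sa (le_trans xa as_).
by rewrite E ltxx in a_lt.
Qed.

Lemma ring_of_segment_rank (S : set (set K)) :
  S `<=` sigma_quotient sigma -> S !=set0 ->
  sigma_rank sigma (ring_of_segment S).
Proof.
move=> SQ S0; apply/sigma_rankP => //; split; last exact: ring_of_segment_compatible.
move=> E; have [C SC] := S0; have [a aP aC] := SQ _ SC.
apply: (proj2 aP); rewrite -E; exists C, a; split=> //.
  by rewrite -aC; apply: sigma_class_refl.
exact: pos_infinite_norm_le.
Qed.

Lemma segment_of_ring_initial (A : set K) : sigma_rank sigma A ->
  initial_segments sigma (segment_of_ring A).
Proof.
move=> /(sigma_rankP _ sigma_bij)[An Acc].
have /compatible_convex_subringP[[B AB] _] := Acc.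
split; first split.
- by move=> _ [a [_ aP] <-]; exists a.
- move=> _ D [a aP <-] [b [Ab bP] <-] ab; exists a => //; split=> //.
  exact: class_le_mem Acc Ab aP bP ab (pos_infinite_norm_le a aP).
(* [A] contains the natural ring and differs from it, so it has an infinite element, whose absolute
   value gives a class. *)
- have [x Ax xN] : exists2 x, A x & ~ natural_ring K x.
    apply: contrapT => h; apply: An; apply/seteqP; split=> [x Ax|].
      by apply: contrapT => xN; apply: h; exists x.
    by rewrite AB; apply: natural_ring_sub.
  exists (sigma_class sigma `|x|), `|x| => //; split; last exact: pos_infinite_norm.
  by rewrite AB in Ax *; apply: subring_norm.
Qed.

Lemma ring_of_segmentK (S : set (set K)) : initial_segments sigma S ->
  segment_of_ring (ring_of_segment S) = S.
Proof.
move=> [[SQ Sinit] _]; apply/seteqP; split=> [_ [a [[C [b [SC Cb ab]]] aP] <-]|C SC].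
  apply: (Sinit _ C) => //; first by exists a.
  rewrite (sigma_quotientE C b)//; last exact: SQ.
  by apply: class_le_sigma_class => //; apply: le_trans ab; apply: ler_norm.
have [a aP aC] := SQ _ SC; exists a => //; split=> //; exists C, a; split=> //.
  by rewrite -aC; apply: sigma_class_refl.
exact: pos_infinite_norm_le.
Qed.

(** For the converse, finite elements lie in every convex subring, and an infinite [x] in [A] has
    [|x|] in a class that [B] meets, hence [x] is in [B] by [class_le_mem]. *)
Lemma segment_of_ring_sub (A B : set K) :
  compatible_convex_subring sigma A -> compatible_convex_subring sigma B ->
  (A `<=` B <-> segment_of_ring A `<=` segment_of_ring B).
Proof.
move=> /compatible_convex_subringP[[A' AA'] _] Bcc.
have /compatible_convex_subringP[[B' BB'] _] := Bcc.
split=> [AB|AB x Ax].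
  by move=> _ [a [Aa aP] <-]; exists a => //; split=> //; apply: AB.
have [xN|xN] := pselect (natural_ring K x).
  by rewrite BB'; apply: natural_ring_sub.
have xP := pos_infinite_norm x xN.
have [|b [Bb bP] bx] := AB (sigma_class sigma `|x|).
  by exists `|x| => //; split=> //; rewrite AA' in Ax *; apply: subring_norm.
by apply: class_le_mem Bcc Bb xP bP _ (lexx _); left.
Qed.

Lemma has_last_segment_of_ring (A : set K) : sigma_rank sigma A ->
  has_last (segment_of_ring A) <->
  exists2 a, pos_infinite K a & sigma_generated sigma a A.
Proof.
move=> AR; have /(sigma_rankP _ sigma_bij)[An Acc] := AR.
have /compatible_convex_subringP[[A' AA'] _] := Acc.
split=> [[_ [a [Aa aP] <-] lasta]|[a aP [_ Aa Amin]]].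
  (* Any element of the last class generates: the class of each infinite [|x|] from [A] lies at or
     below that of [a], so [class_le_mem] applies. *)
  exists a => //; split=> // B Bcc Ba x Ax.
  have [xN|xN] := pselect (natural_ring K x).
    have /compatible_convex_subringP[[B' ->] _] := Bcc.
    exact: natural_ring_sub.
  have xP := pos_infinite_norm x xN.
  apply: (class_le_mem B `|x| a x Bcc Ba xP aP _ (lexx _)).
  apply: lasta; exists `|x| => //; split=> //.
  by rewrite AA' in Ax *; apply: subring_norm.
exists (sigma_class sigma a); first by exists a.
move=> _ [c [Ac cP] <-].
have aQ : sigma_quotient sigma (sigma_class sigma a) by exists a.
have cQ : sigma_quotient sigma (sigma_class sigma c) by exists c.
have [//|[->|ac]] := class_le_total sigma_homo sigma_ge_sqr cQ aQ; first by left.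
(* Minimality of [A] is tested against the ring of the single class of [a]; no initial segment is
   required there. It would bound [c] by some [b] equivalent to [a], although the class of [c] is
   supposed to lie strictly above. *)
have Bcc : compatible_convex_subring sigma
    (ring_of_segment [set sigma_class sigma a]).
  by apply: ring_of_segment_compatible; [move=> _ ->|exists (sigma_class sigma a)].
have [|_ [b [-> ab cb]]] := Amin _ Bcc _ c Ac.
  exists (sigma_class sigma a), a; split=> //; first exact: sigma_class_refl.
  exact: pos_infinite_norm_le.
have := ac _ _ ab (sigma_class_refl c cP).
by rewrite ltNge (le_trans (ler_norm c) cb).
Qed.
End SigmaRank.

(** * The two order isomorphisms *)

Lemma order_isomorphic_restrict (T U : Type) (F P : set (set T))
    (G Q : set (set U)) (f : set T -> set U) :
  set_bij F G f ->
  (forall X Y, F X -> F Y -> (X `<=` Y <-> f X `<=` f Y)) ->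
  (forall X, F X -> (P X <-> Q (f X))) ->
  order_isomorphic (F `&` P) (G `&` Q).
Proof.
move=> [fFG finj fsurj] fmono PQ; exists f; split; last first.
  by move=> X Y [FX _] [FY _]; apply: fmono.
split=> [X [FX PX]|X Y /set_mem[FX _] /set_mem[FY _]|Y [GY QY]].
- by split; [apply: fFG|apply/PQ].
- by apply: finj; apply: mem_set.
- by have [X FX fX] := fsurj _ GY; subst Y; exists X => //; split=> //; apply/PQ.
Qed.

Theorem theorem5p2 (K : realFieldType) (sigma : {rmorphism K -> K})
    (K_nonarchimedean : ~ Num.archimedean_axiom K)
    (sigma_bij : bijective sigma)
    (sigma_homo : {homo sigma : x y / x <= y})
    (sigma_neq_id : ~ (sigma =1 id))
    (sigma_ge_sqr : forall a : K, pos_infinite K a -> a ^+ 2 <= sigma a) :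
  order_isomorphic (sigma_rank sigma) (initial_segments sigma) /\
  order_isomorphic (principal_sigma_rank sigma)
                   (initial_segments_with_last sigma).
Proof.
have rank_sub X Y : sigma_rank sigma X -> sigma_rank sigma Y ->
    (X `<=` Y <-> segment_of_ring sigma X `<=` segment_of_ring sigma Y).
  move=> /(sigma_rankP sigma _ sigma_bij)[_ Xc] /(sigma_rankP sigma _ sigma_bij)[_ Yc].
  exact: segment_of_ring_sub.
have bij : set_bij (sigma_rank sigma) (initial_segments sigma)
    (segment_of_ring sigma).
  split=> [X|X Y /set_mem RX /set_mem RY E|S SI].
  - exact: segment_of_ring_initial.
  (* Injectivity follows from reflecting inclusion in both directions. *)
  - by apply/seteqP; split; apply/rank_sub => //; rewrite E.
  - exists (ring_of_segment S); last exact: ring_of_segmentK.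
    by case: SI => -[SQ _] S0; apply: ring_of_segment_rank.
split; first by exists (segment_of_ring sigma).
(* Both principal families unfold to intersections with the full ones, so the same map serves once
   being generated by one element matches having a last class. *)
apply: (@order_isomorphic_restrict K (set K) (sigma_rank sigma)
  [set A | exists2 a, pos_infinite K a & sigma_generated sigma a A]
  (initial_segments sigma) [set S | has_last S] _ bij rank_sub) => X RX.
apply: iff_sym; exact: has_last_segment_of_ring.
Qed.
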